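(* Let $\gamma=(B,m,\sigma)$ be a fully mutated mutation sequence. Then, as an identity of rational functions in $y=(y_1,\dots,y_n)$, $$\det(I_n - K_\gamma(y)) = \det\bigl(A_+ Z_-(y) + A_- Z_+(y)\bigr).$$
   Context: Fix a positive integer $n$. Write $[x]_+=\max(0,x)$. An $n\times n$ integer matrix $B$ is skew-symmetrizable if there are positive integers $d_1,\dots,d_n$ with $d_iB_{ij}=-d_jB_{ji}$. Let $\mathcal F_{\mathrm{sf}}$ be the set of rational functions $f/g$ in $y_1,\dots,y_n$ with $f,g\in\mathbb Q[y_1,\dots,y_n]$ nonzero polynomials with non-negative coefficients. A Y-seed is a pair $(B,Y)$ with $B$ an $n\times n$ skew-symmetrizable integer matrix and $Y=(Y_1,\dots,Y_n)\in\mathcal F_{\mathrm{sf}}^n$. For $k\in\{1,\dots,n\}$ the Y-seed mutation is $\mu_k(B,Y)=(\widetilde B,\widetilde Y)$ where: $\widetilde B_{ij}=-B_{ij}$ if $i=k$ or $j=k$; otherwise $\widetilde B_{ij}=B_{ij}+B_{ik}B_{kj}$ if $B_{ik}>0$ and $B_{kj}>0$, $\widetilde B_{ij}=B_{ij}-B_{ik}B_{kj}$ if $B_{ik}<0$ and $B_{kj}<0$, and $\widetilde B_{ij}=B_{ij}$ in the remaining cases; and $\widetilde Y_k=Y_k^{-1}$, while for $i\neq k$, $\widetilde Y_i=Y_i(Y_k^{-1}+1)^{-B_{ki}}$ if $B_{ki}\ge 0$ and $\widetilde Y_i=Y_i(Y_k+1)^{-B_{ki}}$ if $B_{ki}\le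 0$. A permutation $\sigma$ of $\{1,\dots,n\}$ acts by $\sigma(B,Y)=(\sigma(B),\sigma(Y))$, $\sigma(B)_{ij}=B_{\sigma^{-1}(i)\sigma^{-1}(j)}$, $\sigma(Y)_i=Y_{\sigma^{-1}(i)}$. A mutation sequence (of length $T\ge 1$) is a triple $\gamma=(B,m,\sigma)$ with $B$ an $n\times n$ skew-symmetrizable integer matrix, $m=(m_1,\dots,m_T)$ a sequence in $\{1,\dots,n\}$ and $\sigma=(\sigma_1,\dots,\sigma_T)$ a sequence of permutations of $\{1,\dots,n\}$. Put $(B(0),Y(0))=(B,(y_1,\dots,y_n))$ and $(B(t),Y(t))=\sigma_t(\mu_{m_t}(B(t-1),Y(t-1)))$ for $t=1,\dots,T$. The cluster transformation of $\gamma$ is $\mu_\gamma(y)=Y(T)$, with components $\mu_1(y),\dots,\mu_n(y)$. Mutation network. Let $\overline{\mathcal E}=\{(i,t)\mid 1\le i\le n,\ 0\le t\le T\}$ and let $\sim$ be the equivalence relation on $\overline{\mathcal E}$ generated by $(i,t-1)\sim(\sigma_t(i),t)$ for $1\le t\le T$ and $i\ne m_t$, and $(i,T)\sim(i,0)$ for all $i$. Put $\mathcal E=\overline{\mathcal E}/\sim$. The mutation network $\mathcal N_\gamma$ is the graph with black vertices labeled by $\mathcal E$, square vertices labeled by $1,\dots,T$, and for each $t$ the following edges (all kept with multiplicity, without cancelling opposite arrows): one broken edge between $t$ and $[(m_t,t-1)]$ and one broken edge between $t$ and $[(\sigma_t(m_t),t)]$; and, for each $i$, $[B_{m_t,i}(t-1)]_+$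 arrows from $t$ to $[(i,t-1)]$ and $[-B_{m_t,i}(t-1)]_+$ arrows from $[(i,t-1)]$ to $t$. For $e\in\mathcal E$ and $1\le t\le T$ let $n^0_{et}$ be the number of broken edges between $e$ and $t$, $n^+_{et}$ the number of arrows from $t$ to $e$, $n^-_{et}$ the number of arrows from $e$ to $t$; let $N_0,N_+,N_-$ be the corresponding $\mathcal E\times T$ matrices. The Neumann-Zagier matrices are $A_+=N_0-N_+$ and $A_-=N_0-N_-$. $\gamma$ is fully mutated if for every $e\in\mathcal E$ there is $t\in\{1,\dots,T\}$ with $(m_t,t-1)\in e$. In that case $t\mapsto[(m_t,t-1)]$ is a bijection $\{1,\dots,T\}\to\mathcal E$, and $\mathcal E\times T$ matrices such as $A_\pm$ are regarded as $T\times T$ matrices through it. Let $J_\gamma(y)=(\partial\mu_i/\partial y_j)_{1\le i,j\le n}$ and $K_\gamma(y)=\mathrm{diag}(\mu_1(y),\dots,\mu_n(y))^{-1}J_\gamma(y)\,\mathrm{diag}(y_1,\dots,y_n)$. For $1\le t\le T$ let $z_{t,+}=\frac{Y_{m_t}(t-1)}{Y_{m_t}(t-1)+1}$ and $z_{t,-}=\frac{1}{Y_{m_t}(t-1)+1}$, and let $Z_\pm(y)=\mathrm{diag}(z_{1,\pm},\dots,z_{T,\pm})$. $I_n$ is the identity matrix. *)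

(* Defs.v *)
From HB Require Import structures.
From mathcomp Require Import all_boot all_order all_fingroup all_algebra.
From mathcomp Require Import generic_quotient fraction mpoly ring.

Set Implicit Arguments.
Unset Strict Implicit.
Unset Printing Implicit Defensive.

Import Order.TTheory GRing.Theory Num.Theory.

Local Open Scope ring_scope.

Notation "x %:F" := (@FracField.tofrac _ x) : ring_scope.

Notation ratfun n := {fraction {mpoly rat[n]}}.

Section RationalFunctions.

Variable n : nat.

Definition yvar (i : 'I_n) : ratfun n := ('X_i : {mpoly rat[n]})%:F.

(* The quotient rule applied to the canonical representative of [f]; by
   [pderiv_frac] any other fraction representing [f] gives the same result. *)
Definition pderiv (i : 'I_n) (f : ratfun n) : ratfun n :=
  let p := \n_(repr f) in let q := \d_(repr f) in
  (mderiv i p * q - p * mderiv i q)%:F / (q ^+ 2)%:F.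

Lemma frac_repr (f : ratfun n) : f = (\n_(repr f))%:F / (\d_(repr f))%:F.
Proof.
have d0 := denom_ratioP (repr f).
rewrite -[LHS]reprK; apply: (canRL (mulfK _)); first by rewrite tofrac_eq0.
rewrite !piE; apply/eqmodP; rewrite /= FracField.equivfE /FracField.mulf.
by rewrite !numden_Ratio ?mulr1 ?oner_eq0 ?mulf_neq0 ?oner_neq0 // mulrC.
Qed.

Lemma pderiv_frac (i : 'I_n) (p q : {mpoly rat[n]}) : q != 0 ->
  pderiv i (p%:F / q%:F)
  = (mderiv i p * q - p * mderiv i q)%:F / (q ^+ 2)%:F.
Proof.
move=> q0; rewrite /pderiv; set f := p%:F / q%:F.
have d0 := denom_ratioP (repr f); have := frac_repr f; move: d0.
set a := (frac (repr f)).1; set b := (frac (repr f)).2 => b0 /eqP.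
rewrite /f eqr_div ?tofrac_eq0 // -!tofracM tofrac_eq => /eqP pb.
apply/eqP; rewrite eqr_div ?tofrac_eq0 ?expf_neq0 // -!tofracM tofrac_eq.
have dpb : mderiv i a * q = mderiv i p * b + p * mderiv i b - a * mderiv i q.
  by rewrite -mderivM pb mderivM addrK.
apply/eqP; transitivity (b * q * (mderiv i a * q) - (a * q) * (q * mderiv i b)).
  by ring.
rewrite dpb; transitivity (b * q * (mderiv i p * b + p * mderiv i b)
  - (a * q) * (b * mderiv i q) - (a * q) * (q * mderiv i b)); first by ring.
by rewrite -pb; ring.
Qed.

Definition nonneg_coef (p : {mpoly rat[n]}) : Prop := forall m, 0 <= p@_m.

Definition subtraction_free (f : ratfun n) : Prop :=
  exists p q : {mpoly rat[n]},
    [/\ p != 0, q != 0, nonneg_coef p, nonneg_coef q & f = p%:F / q%:F].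

Lemma sf_neq0 f : subtraction_free f -> f != 0.
Proof.
by case=> p [q [p0 q0 _ _ ->]]; rewrite mulf_neq0 ?invr_eq0 ?tofrac_eq0.
Qed.

Lemma nonneg_coefM p q :
  nonneg_coef p -> nonneg_coef q -> nonneg_coef (p * q).
Proof.
move=> hp hq m; rewrite mcoeffM; apply: sumr_ge0 => k _; exact: mulr_ge0.
Qed.

Lemma nonneg_coefD_neq0 p q :
  p != 0 -> nonneg_coef p -> nonneg_coef q -> p + q != 0.
Proof.
move=> p0 hp hq; apply: contra p0 => /eqP pq0; apply/eqP/mpolyP => m.
rewrite mcoeff0; apply/eqP; rewrite eq_le hp andbT.
by rewrite -(mcoeff0 rat m) -pq0 mcoeffD lerDl.
Qed.

Lemma sfM f g :
  subtraction_free f -> subtraction_free g -> subtraction_free (f * g).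
Proof.
move=> [p [q [p0 q0 hp hq ->]]] [r [s [r0 s0 hr hs ->]]].
exists (p * r), (q * s); split; rewrite ?mulf_neq0 //; try exact: nonneg_coefM.
by rewrite mulf_div !tofracM.
Qed.

Lemma sfV f : subtraction_free f -> subtraction_free f^-1.
Proof. by case=> p [q [p0 q0 hp hq ->]]; exists q, p; rewrite invf_div. Qed.

Lemma nonneg_coef1 : nonneg_coef 1.
Proof. by move=> m; rewrite mcoeff1 ler0n. Qed.

Lemma sf1 : subtraction_free 1.
Proof.
exists 1, 1; rewrite oner_neq0 tofrac1 divr1.
by split=> //; exact: nonneg_coef1.
Qed.

Lemma sfD1 f : subtraction_free f -> subtraction_free (f + 1).
Proof.
case=> p [q [p0 q0 hp hq ->]]; exists (p + q), q.
have q0' : q%:F != 0 by rewrite tofrac_eq0.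
split=> //; first exact: nonneg_coefD_neq0.
  by move=> m; rewrite mcoeffD addr_ge0.
by rewrite tofracD mulrDl divff.
Qed.

Lemma sfXz f (z : int) : subtraction_free f -> subtraction_free (f ^ z).
Proof.
move=> sf; have sfX k : subtraction_free (f ^+ k).
  by elim: k => [|k IHk]; [exact: sf1 | rewrite exprS; exact: sfM].
by case: z => k; [exact: sfX | exact/sfV/sfX].
Qed.

Lemma sf_yvar i : subtraction_free (yvar i).
Proof.
exists 'X_i, 1; rewrite tofrac1 divr1 oner_neq0; split=> //.
- by rewrite -msize_poly_eq0 msizeX.
- by move=> m; rewrite mcoeffX ler0n.
- exact: nonneg_coef1.
Qed.

End RationalFunctions.

Definition skew_symmetrizable n (B : 'M[int]_n) : Prop :=
  exists d : 'I_n -> int,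
    (forall i, 0 < d i) /\ (forall i j, d i * B i j = - (d j * B j i)).

Section YSeeds.

Variable n : nat.

(* A bare pair: the mutation formulas are total, and the skew-symmetrizability
   of [B] and the subtraction-freeness of [Y] are not part of the type.  They
   are conditions on the initial data: see [ms_skew] and [Y_at_sf] below. *)
Definition yseed : Type := ('M[int]_n * 'rV[ratfun n]_n)%type.

Definition mutB (k : 'I_n) (B : 'M[int]_n) : 'M[int]_n :=
  \matrix_(i, j)
    if (i == k) || (j == k) then - B i j
    else if (0 < B i k) && (0 < B k j) then B i j + B i k * B k j
    else if (B i k < 0) && (B k j < 0) then B i j - B i k * B k j
    else B i j.

Definition mutY (k : 'I_n) (B : 'M[int]_n) (Y : 'rV[ratfun n]_n) :
    'rV[ratfun n]_n :=
  \row_i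
    if i == k then (Y 0 k)^-1
    else if 0 <= B k i then Y 0 i * ((Y 0 k)^-1 + 1) ^ (- B k i)
    else Y 0 i * (Y 0 k + 1) ^ (- B k i).

Definition mut (k : 'I_n) (S : yseed) : yseed := (mutB k S.1, mutY k S.1 S.2).

Definition perm_seed (s : 'S_n) (S : yseed) : yseed :=
  (\matrix_(i, j) S.1 ((s^-1)%g i) ((s^-1)%g j), \row_i S.2 0 ((s^-1)%g i)).

End YSeeds.

(* The steps [1, ..., T] are indexed from 0: [k : 'I_T] stands for the step
   [t = k + 1], which leads from time [k] to time [k + 1]. *)
Record mutseq (n T : nat) := MutSeq {
  ms_B : 'M[int]_n;
  ms_m : 'I_T -> 'I_n;
  ms_sigma : 'I_T -> 'S_n;
  ms_skew : skew_symmetrizable ms_B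
}.

Section MutationSequence.

Variables (n T : nat) (g : mutseq n T).

(* Meaningful for [t <= T]; constant afterwards. *)
Fixpoint seed_at (t : nat) : yseed n :=
  if t is t'.+1 then
    if insub t' is Some k then
      perm_seed (ms_sigma g k) (mut (ms_m g k) (seed_at t'))
    else seed_at t'
  else (ms_B g, \row_i yvar i).

Definition B_at (t : nat) : 'M[int]_n := (seed_at t).1.
Definition Y_at (t : nat) (i : 'I_n) : ratfun n := (seed_at t).2 0 i.

(* In particular no division by zero occurs in the mutations. *)
Lemma Y_at_sf t i : subtraction_free (Y_at t i).
Proof.
rewrite /Y_at; elim: t i => [|t IHt] i /=; first by rewrite mxE; exact: sf_yvar.
case: insubP => [k _ _|_] //; rewrite !mxE; case: eqP => _; first exact: sfV.
by case: ifP => _; apply/sfM/sfXz/sfD1 => //; exact: sfV.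
Qed.

Definition cluster_transf (i : 'I_n) : ratfun n := Y_at T i.

Definition jacobian_mx : 'M[ratfun n]_n :=
  \matrix_(i, j) pderiv j (cluster_transf i).

Definition K_mx : 'M[ratfun n]_n :=
  invmx (diag_mx (\row_i cluster_transf i)) *m jacobian_mx
    *m diag_mx (\row_j yvar j).

Definition timed_index : finType := ('I_n * 'I_T.+1)%type.

Definition pre_time (k : 'I_T) : 'I_T.+1 := widen_ord (leqnSn T) k.
Definition post_time (k : 'I_T) : 'I_T.+1 := lift ord0 k.

Definition sim_gen : rel timed_index := fun x y =>
  [exists k : 'I_T, exists i : 'I_n,
     [&& i != ms_m g k, x == (i, pre_time k)
       & y == (ms_sigma g k i, post_time k)]]
  || [exists i : 'I_n, (x == (i, ord_max)) && (y == (i, ord0))].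

Definition sim : rel timed_index :=
  connect (fun x y => sim_gen x y || sim_gen y x).

Definition sim_class (x : timed_index) : {set timed_index} :=
  [set y | sim x y].

(* The quotient set, realised as the set of equivalence classes. *)
Definition edge_class : finType :=
  {C : {set timed_index} | [exists x, C == sim_class x]}.

Lemma sim_classP x : [exists x', sim_class x == sim_class x'].
Proof. by apply/existsP; exists x. Qed.

Definition cls (x : timed_index) : edge_class :=
  exist _ (sim_class x) (sim_classP x).

Lemma sim_sym : ssrbool.symmetric sim.
Proof. by apply: sym_connect_sym => x y; rewrite orbC. Qed.

Lemma cls_eq x y : (cls x == cls y) = sim x y.
Proof.
rewrite -val_eqE /=; apply/eqP/idP => [/setP/(_ y)|xy].
  by rewrite !inE => ->; exact: connect0.
apply/setP => z; rewrite !inE.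
exact: (same_connect sim_sym xy).
Qed.

Definition N_zero (e : edge_class) (k : 'I_T) : int :=
  (cls (ms_m g k, pre_time k) == e)%:R
  + (cls (ms_sigma g k (ms_m g k), post_time k) == e)%:R.

Definition N_plus (e : edge_class) (k : 'I_T) : int :=
  \sum_(i < n | cls (i, pre_time k) == e) Num.max 0 (B_at k (ms_m g k) i).

Definition N_minus (e : edge_class) (k : 'I_T) : int :=
  \sum_(i < n | cls (i, pre_time k) == e) Num.max 0 (- B_at k (ms_m g k) i).

Definition A_plus (e : edge_class) (k : 'I_T) : int := N_zero e k - N_plus e k.
Definition A_minus (e : edge_class) (k : 'I_T) : int := N_zero e k - N_minus e k.

Definition fully_mutated : Prop :=
  forall e : edge_class, exists k : 'I_T, (ms_m g k, pre_time k) \in val e.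

(* [A_plus] and [A_minus] with their rows reindexed along
   [k |-> cls (ms_m g k, pre_time k)], which is a bijection from ['I_T] to
   [edge_class] when [g] is fully mutated. *)
Definition A_plus_mx : 'M[ratfun n]_T :=
  \matrix_(s, t) (A_plus (cls (ms_m g s, pre_time s)) t)%:~R.
Definition A_minus_mx : 'M[ratfun n]_T :=
  \matrix_(s, t) (A_minus (cls (ms_m g s, pre_time s)) t)%:~R.

Definition Z_plus : 'M[ratfun n]_T :=
  diag_mx (\row_(k < T) (Y_at k (ms_m g k) / (Y_at k (ms_m g k) + 1))).
Definition Z_minus : 'M[ratfun n]_T :=
  diag_mx (\row_(k < T) (Y_at k (ms_m g k) + 1)^-1).

End MutationSequence.

(* Main.v *)
(* Let L(t) be the matrix of logarithmic derivatives (y_j / Y_i(t)) dY_i(t)/dy_j,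
   so that L(0) = 1 and L(T) = K.  One step of the sequence reads
   L(t+1) = (D_t + w_t v_t) L(t), where D_t is the partial permutation
   i |-> sigma(i) for i <> m, v_t is the m-th unit row and w_t holds the
   mutation coefficients.  If G(t) is the T x n incidence matrix of the classes
   at time t, then G(t+1) D_t = G(t) - e_t v_t, and column t of the
   Neumann-Zagier matrix A is e_t - G(t+1) w_t.  With P_t = D_{T-1} ... D_t,
   C the matrix of columns P_{t+1} w_t and X the matrix of rows v_t L(t),
   K = P_0 + C X and G(0) (1 - K) = A X, that is

     [ 1    0 ] [ 1 - K      -C      ]   [ 1 - P_0  -C ] [ 1  0 ]
     [ G(0) 1 ] [   0     A + G(0) C ] = [    0      A ] [ X  1 ].

   A + G(0) C is lower unitriangular, and det (1 - P_0) = 1 because full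
   mutation forbids a class to be transported forever without being mutated. *)

Require Import Defs.
From mathcomp Require Import all_boot all_order all_fingroup all_algebra.
From mathcomp Require Import generic_quotient fraction mpoly ring.

Import Order.TTheory GRing.Theory Num.Theory.
Local Open Scope ring_scope.

(** * Determinant identities over a commutative ring *)

(** In a nonzero term of the Leibniz expansion, [h j <= h (s j)] for all [j], with equality only at
    fixed points of [s]. Since [h] and [h \o s] have the same sum, [s] is the identity. *)
Lemma det_unitriangular_rank (R : comNzRingType) n (M : 'M[R]_n) (h : 'I_n -> nat) :
  (forall i, M i i = 1) -> (forall i j, i != j -> M i j != 0 -> (h i < h j)%N) ->
  \det M = 1.
Proof.
move=> M1 Mh; rewrite /determinant (bigD1 1%g) //= odd_perm1 mul1r.
rewrite big1 => [|i _]; last by rewrite perm1.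
rewrite big1 ?addr0 // => s s1.
case: (boolP [exists i, M i (s i) == 0]) => [/existsP[i /eqP Mi0]|/existsPn Mn0].
  by rewrite (bigD1 i) //= Mi0 mul0r mulr0.
case/negP: s1; apply/eqP/permP => i; rewrite perm1.
have le_h j : (h j <= h (s j) ?= iff (s j == j))%N.
  apply/leqifP; case: (eqVneq (s j) j) => [->|sj]; first exact: eqxx.
  by apply: Mh (Mn0 j); rewrite eq_sym.
have [_] := leqif_sum (fun j (_ : predT j) => le_h j).
by rewrite [in LHS](reindex_perm s) eqxx => /esym/forallP/(_ i)/eqP.
Qed.

Lemma mulmx_sum_outer (R : pzRingType) m T p (a : 'I_T -> 'cV[R]_m) (b : 'I_T -> 'rV[R]_p) :
  (\matrix_(i, t) a t i 0) *m (\matrix_(t, j) b t 0 j) = \sum_t a t *m b t.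
Proof.
apply/matrixP => i j; rewrite !mxE summxE; apply: eq_bigr => t _.
by rewrite !mxE big_ord1.
Qed.

Lemma det_one_sub_cyclic (R : comNzRingType) n T (L P : nat -> 'M[R]_n)
    (D : 'I_T -> 'M[R]_n) (w : 'I_T -> 'cV[R]_n) (v : 'I_T -> 'rV[R]_n)
    (G : nat -> 'M[R]_(T, n)) :
  L 0%N = 1%:M -> (forall t : 'I_T, L t.+1 = D t *m L t + w t *m v t *m L t) ->
  P T = 1%:M -> (forall t : 'I_T, P t = P t.+1 *m D t) -> \det (1%:M - P 0%N) = 1 ->
  G T = G 0%N -> (forall t : 'I_T, G t.+1 *m D t = G t - delta_mx t 0 *m v t) ->
  \det (1%:M - L T) = \det (1%:M - \matrix_(s, t) (G t.+1 *m w t) s 0).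
Proof.
move=> L0 LS PT PS detP GT GS.
pose W := \matrix_(s, t) (G t.+1 *m w t) s 0.
pose A : 'M_T := 1%:M - W.
pose C := \matrix_(i, t) (P t.+1 *m w t) i 0.
pose X := \matrix_(t, j) (v t *m L t) 0 j.
have telL m (f : nat -> 'M[R]_(m, n)) : f T - f 0%N = \sum_(t < T) (f t.+1 - f t).
  by rewrite -(telescope_sumr _ (leq0n T)) big_mkord.
(* Telescopes [P t *m L t], whose increments are [P t.+1 *m w t *m v t *m L t]. *)
have CX : C *m X = L T - P 0%N.
  rewrite mulmx_sum_outer -[L T]mul1mx -PT -[P 0%N]mulmx1 -L0.
  rewrite (telL _ (fun t => P t *m L t)); apply: eq_bigr => t _.
  by rewrite LS mulmxDr PS !mulmxA addrC addKr.
(* Telescopes [G t *m L t]: the increments are the negated outer products of the columns of [A] with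
   the rows of [X]. *)
have AX : A *m X = G 0%N *m (1%:M - L T).
  have -> : G 0%N *m (1%:M - L T) = - (G T *m L T - G 0%N *m L 0%N).
    by rewrite GT L0 mulmxBr mulmx1 opprB.
  rewrite mulmxBl mul1mx mulmx_sum_outer.
  have -> : X = \sum_t delta_mx t 0 *m (v t *m L t).
    rewrite -mulmx_sum_outer -[LHS]mul1mx; congr (_ *m _).
    by apply/matrixP => i j; rewrite !mxE andbT.
  rewrite (telL _ (fun t => G t *m L t)) -sumrB -sumrN; apply: eq_bigr => t _.
  rewrite LS mulmxDr !mulmxA GS mulmxBl -!mulmxA.
  by rewrite -[in RHS](addrA (G t *m L t)) [in RHS]addrC addrK opprD opprK.
(* The correction [delta_mx t 0 *m v t] touches row [t] only. Going down from time [T], the rows of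
   index below the current time therefore evolve by right multiplication by the [D t] alone, as in
   [G 0 *m P]. *)
have low k : (k <= T)%N -> forall (s : 'I_T) i, (s < T - k)%N ->
    (G 0%N *m P (T - k)%N) s i = G (T - k)%N s i.
  elim: k => [|k IHk] kT s i; first by rewrite subn0 PT mulmx1 GT.
  move=> sk; have tT : (T - k.+1 < T)%N by rewrite ltn_subrL /= (leq_ltn_trans _ kT).
  have tS : (T - k.+1).+1 = (T - k)%N by rewrite subnSK.
  have := PS (Ordinal tT); rewrite /= => ->; rewrite mulmxA tS mxE.
  transitivity ((G (T - k)%N *m D (Ordinal tT)) s i).
    rewrite [RHS]mxE; apply: eq_bigr => j _; rewrite IHk ?(ltnW kT) //.
    by rewrite -tS ltnW.
  have := GS (Ordinal tT); rewrite /= tS => ->; rewrite !mxE big_ord1 !mxE.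
  by rewrite andbT -val_eqE /= ltn_eqF // mul0r subr0.
have detAGC : \det (A + G 0%N *m C) = 1.
  have entry s t : (A + G 0%N *m C) s t = (s == t)%:R
      + ((G 0%N *m P t.+1 - G t.+1) *m w t) s 0.
    rewrite mulmxBl -mulmxA !mxE addrAC -addrA; congr (_ + (_ - _)).
    by apply: eq_bigr => i _; rewrite !mxE.
  (* For [s <= t], row [s] lies below time [t.+1], so [low] cancels the second summand of
     [entry]. *)
  have entry0 (s t : 'I_T) : (s <= t)%N -> (A + G 0%N *m C) s t = (s == t)%:R.
    move=> st; rewrite entry [X in _ + X]mxE big1 ?addr0 // => i _.
    have := low (T - t.+1)%N (leq_subr _ _) s i; rewrite subKn // => lows.
    by rewrite [X in X * _]mxE [X in _ + X]mxE lows // subrr mul0r.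
  rewrite det_trig; first by rewrite big1 // => i _; rewrite entry0 ?eqxx.
  apply/is_trig_mxP => s t st; rewrite entry0 ?(ltnW st) //.
  by rewrite -val_eqE ltn_eqF.
have fact : block_mx 1%:M 0 (G 0%N) 1%:M *m
      block_mx (1%:M - L T) (- C) 0 (A + G 0%N *m C)
    = block_mx (1%:M - P 0%N) (- C) 0 A *m block_mx 1%:M 0 X 1%:M.
  rewrite !mulmx_block !(mul0mx, mulmx0, mul1mx, mulmx1, addr0, add0r) AX.
  rewrite mulNmx CX mulmxN; congr block_mx; last by rewrite addrC addrK.
  by rewrite opprB addrA subrK.
have := congr1 determinant fact.
rewrite !det_mulmx !det_lblock !det_ublock !det1 detAGC detP.
by rewrite !mul1r !mulr1.
Qed.

(** * Logarithmic derivatives of rational functions *)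

Lemma ratfun_fracP n (f : ratfun n) :
  exists p q : {mpoly rat[n]}, [/\ q != 0, q%:F != 0 & f = p%:F / q%:F].
Proof.
exists \n_(repr f), \d_(repr f); rewrite tofrac_eq0 (denom_ratioP (repr f)).
by split; last exact: frac_repr.
Qed.

Lemma quotient_ruleD (F : fieldType) (p q r s p' q' r' s' : F) :
  q != 0 -> s != 0 ->
  ((p' * s + p * s' + (r' * q + r * q')) * (q * s)
     - (p * s + r * q) * (q' * s + q * s')) / (q * s) ^+ 2
  = (p' * q - p * q') / q ^+ 2 + (r' * s - r * s') / s ^+ 2.
Proof. by move=> q0 s0; field; rewrite q0 s0. Qed.

Lemma quotient_ruleM (F : fieldType) (p q r s p' q' r' s' : F) :
  q != 0 -> s != 0 ->
  ((p' * r + p * r') * (q * s) - (p * r) * (q' * s + q * s')) / (q * s) ^+ 2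
  = (p' * q - p * q') / q ^+ 2 * (r / s) + p / q * ((r' * s - r * s') / s ^+ 2).
Proof. by move=> q0 s0; field; rewrite q0 s0. Qed.

Lemma pderivD n (j : 'I_n) (f g : ratfun n) :
  pderiv j (f + g) = pderiv j f + pderiv j g.
Proof.
have [p [q [q0 qF ->]]] := ratfun_fracP n f.
have [r [s [s0 sF ->]]] := ratfun_fracP n g.
have -> : p%:F / q%:F + r%:F / s%:F = (p * s + r * q)%:F / (q * s)%:F.
  by rewrite tofracD !tofracM (addf_div _ _ qF sF).
rewrite (pderiv_frac j p q0) (pderiv_frac j r s0).
rewrite (pderiv_frac j (p * s + r * q) (mulf_neq0 q0 s0)).
rewrite mderivD !mderivM !(tofracB, tofracD, tofracM, tofracXn).
exact: (quotient_ruleD _ _ _ _ _ _ _ _ _ qF sF).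
Qed.

Lemma pderivM n (j : 'I_n) (f g : ratfun n) :
  pderiv j (f * g) = pderiv j f * g + f * pderiv j g.
Proof.
have [p [q [q0 qF ->]]] := ratfun_fracP n f.
have [r [s [s0 sF ->]]] := ratfun_fracP n g.
have -> : p%:F / q%:F * (r%:F / s%:F) = (p * r)%:F / (q * s)%:F.
  by rewrite !tofracM; exact: mulf_div.
rewrite (pderiv_frac j p q0) (pderiv_frac j r s0).
rewrite (pderiv_frac j (p * r) (mulf_neq0 q0 s0)).
rewrite !mderivM !(tofracB, tofracD, tofracM, tofracXn).
exact: (quotient_ruleM _ _ _ _ _ _ _ _ _ qF sF).
Qed.

Lemma pderiv_tofrac n (j : 'I_n) (p : {mpoly rat[n]}) :
  pderiv j p%:F = (mderiv j p)%:F.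
Proof.
have := pderiv_frac j p (oner_neq0 _); rewrite tofrac1 divr1 => ->.
by rewrite -mpolyC1 mderivC mpolyC1 mulr1 mulr0 subr0 expr1n tofrac1 divr1.
Qed.

(** The operator y_j d/dy_j log. It turns the multiplicative mutation rule into a linear one, and
    its values on the cluster transformation are the entries of K. *)
Definition logd {n} (j : 'I_n) (f : ratfun n) : ratfun n := yvar j * pderiv j f / f.

Lemma logd_yvar n (i j : 'I_n) : logd j (yvar i) = (i == j)%:R.
Proof.
rewrite /logd pderiv_tofrac mderivX mnmE.
case: eqVneq => [->|_]; last by rewrite scale0r tofrac0 mulr0 mul0r.
have -> : (U_(j) - U_(j) = 0 :> 'X_{1..n})%MM by apply/mnmP => k; rewrite !mnmE subnn.
rewrite mpolyX0 scale1r tofrac1 mulr1 divff //.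
exact: sf_neq0 (sf_yvar j).
Qed.

Lemma pderiv1 n (j : 'I_n) : pderiv j 1 = 0.
Proof. by rewrite -tofrac1 pderiv_tofrac -mpolyC1 mderivC tofrac0. Qed.

Lemma logd1 n (j : 'I_n) : logd j 1 = 0.
Proof. by rewrite /logd pderiv1 mulr0 mul0r. Qed.

Lemma log_derivM (F : fieldType) (f g y f' g' : F) : f != 0 -> g != 0 ->
  y * (f' * g + f * g') / (f * g) = y * f' / f + y * g' / g.
Proof. by move=> f0 g0; field; rewrite f0 g0. Qed.

Lemma log_derivD1 (F : fieldType) (f y f' : F) : f != 0 -> f + 1 != 0 ->
  y * (f' + 0) / (f + 1) = f / (f + 1) * (y * f' / f).
Proof. by move=> f0 f1; field; rewrite f0 f1. Qed.

Lemma logdM n (j : 'I_n) (f g : ratfun n) : f != 0 -> g != 0 ->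
  logd j (f * g) = logd j f + logd j g.
Proof.
move=> f0 g0; rewrite /logd pderivM; exact: (log_derivM _ _ _ _ _ _ f0 g0).
Qed.

Lemma logdV n (j : 'I_n) (f : ratfun n) : f != 0 -> logd j f^-1 = - logd j f.
Proof.
move=> f0; apply/eqP; rewrite -addr_eq0 addrC -logdM ?invr_eq0 //.
by rewrite divff // logd1.
Qed.

Lemma logdXz n (j : 'I_n) (f : ratfun n) (z : int) : f != 0 ->
  logd j (f ^ z) = z%:~R * logd j f.
Proof.
move=> f0; have logdX k : logd j (f ^+ k) = k%:R * logd j f.
  elim: k => [|k IHk]; first by rewrite expr0 logd1 mul0r.
  by rewrite exprS logdM ?expf_neq0 // IHk -natr1 mulrDl mul1r addrC.
case: z => k; first exact: logdX.
by rewrite NegzE mulrNz mulNr -[k.+1%:~R * _]logdX -logdV ?expf_neq0.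
Qed.

Lemma logdD1 n (j : 'I_n) (f : ratfun n) : f != 0 -> f + 1 != 0 ->
  logd j (f + 1) = f / (f + 1) * logd j f.
Proof.
move=> f0 f1; rewrite /logd pderivD pderiv1; exact: (log_derivD1 _ _ _ _ f0 f1).
Qed.

(** * Classes of the mutation network as merging forward orbits *)

(** By induction on the path: a forward first edge adds an iteration on the side of [x], a backward
    one on the side of [y]. *)
Lemma connect_functional_merge (X : finType) (F : X -> X) (r : rel X) x y :
  (forall u v, r u v -> v = F u) -> connect (fun u v => r u v || r v u) x y ->
  exists a b, iter a F x = iter b F y.
Proof.
move=> rF /connectP[p]; elim: p x => [|z p IHp] x /=.
  by move=> _ ->; exists 0%N, 0%N.
case/andP=> /orP[] /rF -> /IHp{IHp} IHp /IHp[a [b ab]].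
  by exists a.+1, b; rewrite iterSr.
by exists a, b.+1; rewrite -iterSr !iterS ab.
Qed.

(** [h] is the hitting time of [fixed], which drops by one at each step outside it. *)
Lemma rank_of_fixed_reach (X : Type) (F : X -> X) (fixed : pred X) :
  (forall x, exists a, fixed (iter a F x)) ->
  exists h : X -> nat, forall x, ~~ fixed x -> (h (F x) < h x)%N.
Proof.
move=> ex; exists (fun x => ex_minn (ex x)) => x x_mov.
case: (ex_minnP (ex x)) => [[|a] /=]; first by rewrite (negPf x_mov).
rewrite -iterS iterSr => fa _; case: (ex_minnP (ex (F x))) => b _ /(_ a fa).
by rewrite ltnS.
Qed.

Section MutationNetwork.

Variables (n T : nat) (g : mutseq n T).
Local Notation m := (ms_m g).
Local Notation sg := (ms_sigma g).

(* Moves one step forward in time inside a [sim]-class, stopping at the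
   mutated indices, which are the fixed points. *)
Definition advance (x : timed_index n T) : timed_index n T :=
  if insub (x.2 : nat) is Some k then
    if x.1 == m k then x else (sg k x.1, post_time k)
  else (x.1, ord0).

Lemma advance_pre i k : advance (i, pre_time k) =
  if i == m k then (i, pre_time k) else (sg k i, post_time k).
Proof. by rewrite /advance /= valK. Qed.

Lemma advance_max i : advance (i, ord_max) = (i, ord0).
Proof. by rewrite /advance /= insubN // ltnn. Qed.

Lemma sim_gen_advance x y : sim_gen g x y -> y = advance x.
Proof.
case/orP=> [/existsP[k /existsP[i /and3P[im /eqP-> /eqP->]]]|].
  by rewrite advance_pre (negPf im).
by case/existsP=> i /andP[/eqP-> /eqP->]; rewrite advance_max.
Qed.

Lemma sim_post i k : i != m k -> sim g (i, pre_time k) (sg k i, post_time k).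
Proof.
move=> im; apply/connect1/orP; left; apply/orP; left.
by apply/existsP; exists k; apply/existsP; exists i; rewrite im !eqxx.
Qed.

Lemma sim_wrap i : sim g (i, ord_max) (i, ord0).
Proof.
apply/connect1/orP; left; apply/orP; right.
by apply/existsP; exists i; rewrite !eqxx.
Qed.

Lemma iter_advance_mutated a k : iter a advance (m k, pre_time k) = (m k, pre_time k).
Proof. by rewrite iter_fix // advance_pre eqxx. Qed.

(** Mutated indices are fixed points of [advance], so orbits from two of them meet only if they
    coincide. This is the injectivity of the map from steps to classes. *)
Lemma sim_mutated s t : sim g (m s, pre_time s) (m t, pre_time t) = (s == t).
Proof.
apply/idP/eqP => [|->]; last exact: connect0.
case/(connect_functional_merge _ _ _ _ _ sim_gen_advance) => a [b].
by rewrite !iter_advance_mutated => -[_ /val_inj].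
Qed.

Lemma sim_eqr x y z : sim g y z -> sim g x y = sim g x z.
Proof. by move=> yz; apply: (same_connect_r (sim_sym g)). Qed.

(** Full mutation puts a mutated index, fixed by [advance], in every class, so every forward orbit
    reaches a fixed point and the hitting time is a rank. As [T] is positive, the wrap from time [T]
    to time 0 is a genuine move. *)
Lemma advance_rank : (0 < T)%N -> fully_mutated g ->
  exists h : timed_index n T -> nat,
    (forall k i, i != m k -> (h (sg k i, post_time k) < h (i, pre_time k))%N) /\
    (forall i, (h (i, ord0) < h (i, ord_max))%N).
Proof.
move=> T_gt0 full.
have reach x : exists a, advance (iter a advance x) == iter a advance x.
  have [k] := full (cls g x); rewrite inE.
  case/(connect_functional_merge _ _ _ _ _ sim_gen_advance) => a [b] ab.
  by exists a; rewrite ab iter_advance_mutated advance_pre eqxx.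
have [h hP] := rank_of_fixed_reach _ _ (fun x => advance x == x) reach.
exists h; split=> [k i im|i].
  have := hP (i, pre_time k); rewrite advance_pre (negPf im); apply.
  by rewrite xpair_eqE -[post_time k == _]val_eqE /= gtn_eqF ?andbF.
have := hP (i, ord_max); rewrite advance_max; apply.
by rewrite xpair_eqE -[ord0 == _]val_eqE /= ltn_eqF ?andbF.
Qed.

End MutationNetwork.

(** * Seed mutation in logarithmic form *)

(** The same [d] works: transposition exchanges the two sign cases, and both products
    [d i * (B i k * B k j)] and [d j * (B j k * B k i)] equal - d_k B_ki B_kj. This serves to give
    every [B_at g t] a zero diagonal. *)
Lemma mutB_skew n (k : 'I_n) (B : 'M[int]_n) :
  skew_symmetrizable B -> skew_symmetrizable (mutB k B).
Proof.
case=> d [d_gt0 dB]; exists d; split=> // i j; rewrite !mxE orbC.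
case: ifP => _; first by rewrite mulrN dB mulrN.
have sgn a b : ((0 < B a b) = (B b a < 0)).
  have := dB a b; have := d_gt0 a; have := d_gt0 b => db da dab.
  by rewrite -(pmulr_rgt0 _ da) dab oppr_gt0 pmulr_rlt0.
have swap : d i * (B i k * B k j) = d j * (B j k * B k i).
  by rewrite !mulrA (dB i k) (dB j k); ring.
rewrite (sgn j k) (sgn k i) -(sgn k j) -(sgn i k) [X in _ = - (_ * X)](_ : _ =
  if (0 < B i k) && (0 < B k j) then B j i - B j k * B k i
  else if (B i k < 0) && (B k j < 0) then B j i + B j k * B k i else B j i).
  by case: ifP => _; [|case: ifP => _]; rewrite ?mulrDr ?mulrN ?swap dB; ring.
by case: (ltgtP (B i k) 0) => _; case: (ltgtP (B k j) 0).
Qed.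

Lemma perm_seed_skew n (s : 'S_n) (S : yseed n) :
  skew_symmetrizable S.1 -> skew_symmetrizable (perm_seed s S).1.
Proof.
case=> d [d_gt0 dB]; exists (fun i => d ((s^-1)%g i)).
by split=> // i j; rewrite !mxE.
Qed.

Lemma B_at_skew n T (g : mutseq n T) t : skew_symmetrizable (B_at g t).
Proof.
rewrite /B_at; elim: t => [|t IHt] /=; first exact: ms_skew.
by case: insub => // k; apply/perm_seed_skew/mutB_skew.
Qed.

Lemma skew_diag0 n (B : 'M[int]_n) i : skew_symmetrizable B -> B i i = 0.
Proof.
case=> d [d_gt0 dB]; apply/eqP; have /eqP := dB i i.
by rewrite -addr_eq0 -mulr2n mulrn_eq0 /= mulf_eq0 (gt_eqF (d_gt0 i)).
Qed.

Lemma Y_at_neq0 n T (g : mutseq n T) t i : Y_at g t i != 0.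
Proof. exact: sf_neq0 (Y_at_sf g t i). Qed.

Lemma Y_atD1_neq0 n T (g : mutseq n T) t i : Y_at g t i + 1 != 0.
Proof. exact: sf_neq0 (sfD1 (Y_at_sf g t i)). Qed.

(** Coefficient of d log Y_m in d log of the mutated Y_i. It pairs arrows leaving the square vertex
    with z_- and arrows entering it with z_+, as A_+ Z_- + A_- Z_+ does. *)
Definition mut_coef {n T} (g : mutseq n T) (k : 'I_T) (i : 'I_n) : ratfun n :=
  (Num.max 0 (B_at g k (ms_m g k) i))%:~R * (Y_at g k (ms_m g k) + 1)^-1
  + (Num.max 0 (- B_at g k (ms_m g k) i))%:~R
    * (Y_at g k (ms_m g k) / (Y_at g k (ms_m g k) + 1)).

Lemma mut_coef_self n T (g : mutseq n T) k : mut_coef g k (ms_m g k) = 0.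
Proof.
by rewrite /mut_coef skew_diag0 ?oppr0 ?maxxx ?mul0r ?addr0 //; exact: B_at_skew.
Qed.

Lemma Y_at_succ n T (g : mutseq n T) (k : 'I_T) i :
  Y_at g k.+1 (ms_sigma g k i) =
  mutY (ms_m g k) (B_at g k) (seed_at g k).2 0 i.
Proof. by rewrite /Y_at /= valK /= mxE permK. Qed.

(** The case of a non-negative exchange entry [b]: the factor 1/(y+1) is y^-1/(y^-1 + 1), and the
    literal 0 stands for the vanishing part max(0, -b). *)
Lemma log_coef_inv (F : fieldType) (b y l : F) : y != 0 -> y + 1 != 0 ->
  - b * (y^-1 / (y^-1 + 1) * - l) = (b / (y + 1) + 0 * (y / (y + 1))) * l.
Proof.
move=> y0 y1; have -> : y^-1 + 1 = (y + 1) / y by rewrite mulrDl divff // mul1r addrC.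
by field; rewrite y0 y1.
Qed.

Lemma logd_mut n T (g : mutseq n T) (k : 'I_T) i j :
  logd j (Y_at g k.+1 (ms_sigma g k i)) =
  if i == ms_m g k then - logd j (Y_at g k (ms_m g k))
  else logd j (Y_at g k i) + mut_coef g k i * logd j (Y_at g k (ms_m g k)).
Proof.
rewrite Y_at_succ mxE -!/(Y_at _ _ _) /mut_coef.
have y0 := Y_at_neq0 _ _ g k (ms_m g k); have y1 := Y_atD1_neq0 _ _ g k (ms_m g k).
have y2 : (Y_at g k (ms_m g k))^-1 + 1 != 0.
  exact: sf_neq0 (sfD1 (sfV (Y_at_sf g k (ms_m g k)))).
have yi := Y_at_neq0 _ _ g k i.
case: ifP => _; first exact: (logdV _ _ _ y0).
have [b0|/ltW b0] := leP 0 (B_at g k (ms_m g k) i).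
  have Nb0 : - B_at g k (ms_m g k) i <= 0 by rewrite oppr_le0.
  rewrite (max_l Nb0) (logdM _ _ _ _ yi (expfz_neq0 _ y2)).
  rewrite (logdXz _ _ _ _ y2) (logdD1 _ _ _ (invr_neq0 y0) y2) (logdV _ _ _ y0).
  by rewrite mulrNz (log_coef_inv _ _ _ _ y0 y1).
have Nb0 : 0 <= - B_at g k (ms_m g k) i by rewrite oppr_ge0.
rewrite (max_r Nb0) (logdM _ _ _ _ yi (expfz_neq0 _ y1)).
rewrite (logdXz _ _ _ _ y1) (logdD1 _ _ _ y0 y1).
by rewrite [(0 : int)%:~R]mulr0z mul0r add0r mulrA.
Qed.

(** * The matrices attached to the sequence, and the conclusion *)

(** For [k <= T] this is D_{T-1} ... D_{T-k}, the product of the last [k] factors; P_t is its value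
    at [T - t]. *)
Fixpoint backward_prod {R : pzSemiRingType} {n T} (D : 'I_T -> 'M[R]_n) k : 'M[R]_n :=
  if k is k'.+1 then
    if insub (T - k)%N is Some t then backward_prod D k' *m D t else 1%:M
  else 1%:M.

Lemma backward_prodS (R : pzSemiRingType) n T (D : 'I_T -> 'M[R]_n) (t : 'I_T) :
  backward_prod D (T - t) = backward_prod D (T - t.+1) *m D t.
Proof. by rewrite -subnSK //= subnSK // subKn ?valK // ltnW. Qed.

Section Assembly.

Variables (n T : nat) (g : mutseq n T).
Local Notation m := (ms_m g).
Local Notation sg := (ms_sigma g).

Definition log_jacobian t : 'M[ratfun n]_n := \matrix_(i, j) logd j (Y_at g t i).

Definition transport_mx (k : 'I_T) : 'M[ratfun n]_n :=
  \matrix_(j, i) ((i != m k) && (j == sg k i))%:R.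

(** The column w_t. Its entry -1 comes from the inversion of Y_m, since [transport_mx] omits the
    mutated index. *)
Definition jump_col (k : 'I_T) : 'cV[ratfun n]_n :=
  \col_j let i := ((sg k)^-1)%g j in if i == m k then -1 else mut_coef g k i.

Definition class_mx t : 'M[ratfun n]_(T, n) :=
  \matrix_(s, i) (sim g (m s, pre_time s) (i, inord t))%:R.

Lemma inord_pre (k : 'I_T) : inord k = pre_time k.
Proof. by apply: val_inj; rewrite /= inordK // ltnW // ltnS. Qed.

Lemma inord_post (k : 'I_T) : inord k.+1 = post_time k.
Proof. by apply: val_inj; rewrite /= inordK // ltnS. Qed.

Lemma inord_last : inord T = ord_max :> 'I_T.+1.
Proof. by apply: val_inj; rewrite /= inordK. Qed.

Lemma inord_first : inord 0 = ord0 :> 'I_T.+1.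
Proof. by apply: val_inj; rewrite /= inordK. Qed.

Lemma log_jacobian0 : log_jacobian 0 = 1%:M.
Proof. by apply/matrixP => i j; rewrite !mxE /Y_at /= mxE logd_yvar. Qed.

Lemma log_jacobianS (k : 'I_T) : log_jacobian k.+1 =
  transport_mx k *m log_jacobian k
  + jump_col k *m delta_mx 0 (m k) *m log_jacobian k.
Proof.
apply/matrixP => j l; rewrite -mulmxA -rowE -[j](permKV (sg k)).
move: (((sg k)^-1)%g j) => {j} i; rewrite mxE logd_mut [RHS]mxE.
rewrite [X in _ = _ + X]mxE big_ord1 [jump_col k _ _]mxE [row _ _ _ _]mxE permK.
rewrite [log_jacobian k (m k) l]mxE [X in _ = X + _]mxE.
case: (eqVneq i (m k)) => [->|im].
  rewrite /= eqxx mulN1r big1 ?add0r // => a _; rewrite mxE (inj_eq perm_inj) eq_sym.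
  by case: eqVneq; rewrite mul0r.
rewrite /= (negPf im) (bigD1 i) //= big1 ?addr0 => [|a ai].
  by rewrite !mxE im eqxx mul1r.
by rewrite mxE (inj_eq perm_inj) [i == a]eq_sym (negPf ai) andbF mul0r.
Qed.

(** An unmutated index keeps its class from time [k] to [k.+1]. The mutated column is lost on the
    left, and by [sim_mutated] its only nonzero entry is in row [k], which the right side
    subtracts. *)
Lemma class_mxS (k : 'I_T) :
  class_mx k.+1 *m transport_mx k = class_mx k - delta_mx k (0 : 'I_1) *m delta_mx 0 (m k).
Proof.
apply/matrixP => s i; rewrite !mxE big_ord1 !mxE inord_pre andbT.
case: (eqVneq i (m k)) => [->|im].
  rewrite sim_mutated mulr1 subrr big1 // => a _.
  by rewrite !mxE eqxx mulr0.
rewrite mulr0 subr0 (bigD1 (sg k i)) //= big1 ?addr0 => [|a ai].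
  by rewrite !mxE im eqxx mulr1 inord_post (sim_eqr _ _ _ _ _ _ (sim_post _ _ _ _ _ im)).
by rewrite !mxE (negPf ai) andbF mulr0.
Qed.

Lemma class_mx_cyclic : class_mx T = class_mx 0.
Proof.
apply/matrixP => s i.
by rewrite !mxE inord_last inord_first (sim_eqr _ _ _ _ _ _ (sim_wrap _ _ _ i)).
Qed.

Lemma K_mxE : K_mx g = log_jacobian T.
Proof.
have unitD : diag_mx (\row_i cluster_transf g i) \in unitmx.
  rewrite unitmxE det_diag unitfE; apply/prodf_neq0 => i _.
  rewrite mxE; exact: Y_at_neq0.
rewrite /K_mx -mulmxA; apply: (canLR (mulKmx unitD)).
apply/matrixP => i j; rewrite mul_mx_diag mul_diag_mx !mxE /logd.
rewrite [RHS]mulrC divfK; first exact: mulrC.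
exact: Y_at_neq0.
Qed.

Lemma sum_classE (x : timed_index n T) (k : 'I_T) (f : 'I_n -> int) :
  (\sum_(i < n | cls g (i, pre_time k) == cls g x) f i)%:~R
  = \sum_i (sim g x (i, pre_time k))%:R * (f i)%:~R :> ratfun n.
Proof.
rewrite big_mkcond /= rmorph_sum; apply: eq_bigr => i _.
by rewrite cls_eq sim_sym; case: (sim g x _); rewrite ?mul1r ?mul0r.
Qed.

(** Reindexing by [sg t] moves the sum back to time [t]. The entry -1 of [jump_col] becomes the
    broken edge to the index created by the mutation. *)
Lemma class_jumpE (s t : 'I_T) : (class_mx t.+1 *m jump_col t) s 0 =
  \sum_i (sim g (m s, pre_time s) (i, pre_time t))%:R * mut_coef g t i
  - (sim g (m s, pre_time s) (sg t (m t), post_time t))%:R.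
Proof.
rewrite mxE (reindex_perm (sg t)) (bigD1 (m t)) //=.
rewrite [in RHS](bigD1 (m t)) //= mut_coef_self mulr0 add0r addrC.
rewrite [jump_col t _ _]mxE /= permK eqxx mulrN1 [class_mx _ _ _]mxE inord_post.
congr (_ - _); apply: eq_bigr => i im.
rewrite [jump_col t _ _]mxE /= permK (negPf im) [class_mx _ _ _]mxE inord_post.
by rewrite (sim_eqr _ _ _ _ _ _ (sim_post _ _ _ _ _ im)).
Qed.

(** Since z_- + z_+ = 1, the common broken-edge part d + e keeps coefficient 1. *)
Lemma NZ_column_combine (F : fieldType) (d e p q y : F) : y + 1 != 0 ->
  (d + e - p) * (y + 1)^-1 + (d + e - q) * (y / (y + 1))
  = d - (p * (y + 1)^-1 + q * (y / (y + 1)) - e).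
Proof. by move=> y1; field. Qed.

Lemma NZ_entry (s t : 'I_T) :
  (A_plus_mx g *m Z_minus g + A_minus_mx g *m Z_plus g) s t =
  (s == t)%:R - (class_mx t.+1 *m jump_col t) s 0.
Proof.
have N0 : (N_zero (cls g (m s, pre_time s)) t)%:~R = (s == t)%:R
    + (sim g (m s, pre_time s) (sg t (m t), post_time t))%:R :> ratfun n.
  by rewrite /N_zero !cls_eq ![sim g _ (m s, _)]sim_sym sim_mutated rmorphD /= !rmorph_nat.
rewrite class_jumpE mxE !mul_mx_diag !mxE /A_plus /A_minus !rmorphB /= N0 !sum_classE.
rewrite (NZ_column_combine _ _ _ _ _ _ (Y_atD1_neq0 _ _ g t (m t))).
congr (_ - (_ - _)); rewrite !mulr_suml -big_split; apply: eq_bigr => i _ /=.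
by rewrite mulrDr !mulrA.
Qed.

(** A nonzero entry (j, i) of the full product carries [i] at time 0 to [j] at time [T] without
    mutation. The rank falls along the way, so 1 - P_0 is unitriangular for the rank at time 0. *)
Lemma det_one_sub_transport : (0 < T)%N -> fully_mutated g ->
  \det (1%:M - backward_prod transport_mx T) = 1.
Proof.
move=> T_gt0 full; have [h [h_post h_wrap]] := advance_rank _ _ g T_gt0 full.
(* Only a weak inequality, because [k = 0] is the identity; the wrap to time 0 makes it strict in
   [dropQ]. *)
have drop k : (k <= T)%N -> forall j i, backward_prod transport_mx k j i != 0 ->
    (h (j, ord_max) <= h (i, inord (T - k)))%N.
  elim: k => [|k IHk] kT j i.
    by rewrite subn0 inord_last mxE; case: (eqVneq j i) => [->|]; rewrite ?eqxx.
  have tT : (T - k.+1 < T)%N by rewrite ltn_subrL.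
  rewrite /= insubT mxE => nz.
  have [a] : exists a, backward_prod transport_mx k j a *
      transport_mx (Sub (T - k.+1)%N tT) a i != 0.
    apply/existsP; apply: contraNT nz => /existsPn z.
    by apply/eqP/big1 => a _; apply/eqP; have := z a; rewrite negbK.
  rewrite mulf_eq0 negb_or mxE => /andP[nza].
  case: (boolP (_ && _)) => [/andP[im /eqP a_im] _|]; last by rewrite eqxx.
  rewrite a_im in nza.
  have := h_post _ _ im; rewrite -inord_pre -inord_post /= => h_lt.
by apply: leq_trans (ltnW h_lt); rewrite subnSK //; exact: IHk (ltnW kT) _ _ nza.
pose Q := backward_prod transport_mx T.
have dropQ j i : Q j i != 0 -> (h (j, ord0) < h (i, ord0))%N.
  move/(drop _ (leqnn T)); rewrite subnn inord_first.
  exact: leq_trans (h_wrap j).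
apply: (det_unitriangular_rank _ _ _ (fun i => h (i, ord0))) => [i|i j ij].
  (* A nonzero diagonal entry of [Q] would give [h (i, ord0) < h (i, ord0)]. *)
  rewrite !mxE eqxx; have := dropQ i i; rewrite ltnn.
  by case: (eqVneq (Q i i) 0) => [->|_ /(_ isT)] //; rewrite subr0.
by rewrite !mxE (negPf ij) sub0r oppr_eq0; exact: dropQ.
Qed.

End Assembly.

Theorem theorem1p1 (n T : nat) (n_gt0 : (0 < n)%N) (T_gt0 : (0 < T)%N)
    (g : mutseq n T) (g_full : fully_mutated g) :
  \det (1%:M - K_mx g)
  = \det (A_plus_mx g *m Z_minus g + A_minus_mx g *m Z_plus g).
Proof.
rewrite K_mxE.
have := det_one_sub_cyclic _ _ _ (log_jacobian _ _ g)
  (fun t => backward_prod (transport_mx _ _ g) (T - t)) _ _ _ (class_mx _ _ g)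
  (log_jacobian0 _ _ g) (log_jacobianS _ _ g) _ (backward_prodS _ _ _ _) _
  (class_mx_cyclic _ _ g) (class_mxS _ _ g).
rewrite subnn subn0 => -> //; last exact: det_one_sub_transport.
by congr determinant; apply/matrixP => s t; rewrite NZ_entry !mxE.
Qed.
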